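(* Let $\varepsilon\in(0,1/4)$ and $b=9$. Let $G=(V,E)$ be a graph and run the following procedure. Let $M_1$ be an $(\varepsilon/4)$-approximately maximal matching in $G$. For each edge of $M_1$ put one endpoint in $L$ and the other in $R$; put each vertex of $V\setminus V(M_1)$ independently and uniformly at random into $L$ or $R$. Let $E_2$ be the set of edges $(u,v)\in E$ with $u\in V(M_1)$, $v\notin V(M_1)$, and $u,v$ on different sides of $(L,R)$. Assign capacity $1$ to vertices of $V(M_1)$ and capacity $b$ to the other vertices, and let $M_2$ be any maximal $b$-matching in $(V,E_2)$ with these capacities. Then $$\mu(G)\ge\mathbb E[\mu(G[M_1\cup M_2])]\ge\left(\frac12+\frac1{144}-\varepsilon\right)\mu(G),$$ so that outputting a maximum matching of $G[M_1\cup M_2]$ gives a $\left(\frac12+\frac1{144}-\varepsilon\right)^{-1}<1.973(1+2\varepsilon)$ approximation in expectation.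
   Context: $\mu(H)$ is the maximum matching size of a graph $H$; $V(M)$ is the set of endpoints of a matching $M$; $G[F]$ is the subgraph formed by edge set $F$. A matching $M$ is an $\varepsilon'$-approximately maximal matching in $G$ if it is inclusion-wise maximal in some subgraph of $G$ obtained by deleting at most $\varepsilon'\mu(G)$ vertices. A $b$-matching with capacities $\{b_v\}$ is a multiset of edges in which each vertex $v$ lies in at most $b_v$ elements; maximal means no edge copy can be added while respecting capacities. Expectation is over the random bipartition.
   Formalization: The inequality (1/2+1/144-ε)^{-1} < 1.973(1+2ε) is false for most ε in (0,1/4) (e.g. ε=1/5: 3.258 > 2.762; it holds only for ε below about 0.0114), so it is stated only for ε ≤ 1/88; all other claims are for all ε in (0,1/4). *)

(* Defs.v *)
From HB Require Import structures.
From mathcomp Require Import all_boot all_order all_algebra.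

Set Implicit Arguments.
Unset Strict Implicit.
Unset Printing Implicit Defensive.

Import Order.TTheory GRing.Theory Num.Theory.
Local Open Scope ring_scope.

(* A graph on the finite vertex type V is given by its set of edges, an edge
   being a two-element set of vertices.  The subgraph G[F] formed by an edge
   set F is then F itself: isolated vertices play no role for matchings. *)
Definition simple_graph (V : finType) (E : {set {set V}}) : Prop :=
  forall f : {set V}, f \in E -> #|f| = 2%N.

(* V(M) is [cover M]. *)
Definition matching (V : finType) (E M : {set {set V}}) : bool :=
  (M \subset E) && trivIset M.

Definition mu (V : finType) (E : {set {set V}}) : nat :=
  \max_(M : {set {set V}} | matching E M) #|M|.

Definition maximum_matching (V : finType) (E M : {set {set V}}) : Prop :=
  matching E M /\ #|M| = mu E.

Definition delete_vertices (V : finType) (E : {set {set V}}) (D : {set V}) :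
  {set {set V}} := [set f in E | [disjoint f & D]].

Definition approx_maximal_matching (R : realFieldType) (V : finType)
    (E : {set {set V}}) (eps : R) (M : {set {set V}}) : Prop :=
  exists D : {set V},
    #|D|%:R <= eps * (mu E)%:R /\ maxset (matching (delete_vertices E D)) M.

(* Multisets of edges are given by their multiplicity functions. *)
Definition bmatching (V : finType) (E : {set {set V}}) (cap : V -> nat)
    (x : {ffun {set V} -> nat}) : Prop :=
  (forall f : {set V}, (0 < x f)%N -> f \in E) /\
  (forall v : V, (\sum_(f : {set V} | v \in f) x f <= cap v)%N).

Definition add_copy (V : finType) (x : {ffun {set V} -> nat}) (f : {set V}) :
  {ffun {set V} -> nat} := [ffun g => (x g + (g == f))%N].

Definition maximal_bmatching (V : finType) (E : {set {set V}}) (cap : V -> nat)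
    (x : {ffun {set V} -> nat}) : Prop :=
  bmatching E cap x /\
  forall f : {set V}, f \in E -> ~ bmatching E cap (add_copy x f).

Definition edges_of (V : finType) (x : {ffun {set V} -> nat}) : {set {set V}} :=
  [set f | (0 < x f)%N].

(* A bipartition (L, R) is a boolean labelling of the vertices, with
   L = {v | s v} and R = {v | ~~ s v}. *)
Definition splits (V : finType) (M : {set {set V}}) (o : V -> bool) : Prop :=
  forall u v : V, u != v -> [set u; v] \in M -> o u != o v.

(* The possible outcomes of the random bipartition, the sides of the vertices
   of V(M1) being prescribed by o. *)
Definition extends (V : finType) (M1 : {set {set V}}) (o : V -> bool)
    (s : {ffun V -> bool}) : Prop :=
  forall v : V, v \in cover M1 -> s v = o v.

(* Product distribution: the side of a vertex of V(M1) is o v, the sides of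
   the other vertices are independent fair coins. *)
Definition bipartition_prob (R : realFieldType) (V : finType)
    (M1 : {set {set V}}) (o : V -> bool) (s : {ffun V -> bool}) : R :=
  \prod_(v : V) (if v \in cover M1 then (s v == o v)%:R else 1 / 2).

Definition expectation (R : realFieldType) (V : finType)
    (M1 : {set {set V}}) (o : V -> bool) (X : {ffun V -> bool} -> R) : R :=
  \sum_(s : {ffun V -> bool}) bipartition_prob R M1 o s * X s.

Definition crossing_edges (V : finType) (E M1 : {set {set V}})
    (s : {ffun V -> bool}) : {set {set V}} :=
  [set f in E | [exists u : V, exists v : V,
     [&& f == [set u; v], u \in cover M1, v \notin cover M1 & s u != s v]]].

Definition capacity (V : finType) (b : nat) (M1 : {set {set V}}) (v : V) : nat :=
  if v \in cover M1 then 1%N else b.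

Definition output_graph (V : finType) (M1 : {set {set V}})
    (x : {ffun {set V} -> nat}) : {set {set V}} := M1 :|: edges_of x.

(* The random output [out] is always a matching of the graph, and its expected
   size is within a factor alpha of the optimum. *)
Definition approximation_in_expectation (R : realFieldType) (V : finType)
    (E M1 : {set {set V}}) (o : V -> bool) (alpha : R)
    (out : {ffun V -> bool} -> {set {set V}}) : Prop :=
  (forall s : {ffun V -> bool}, extends M1 o s -> matching E (out s)) /\
  (mu E)%:R <= alpha * expectation M1 o (fun s => #|out s|%:R).

(* Main.v *)
(* Let m = #|M1|, let p match every vertex to its partner in a maximum matching
   of E, and call an edge of M1 augmentable if p sends both its endpoints
   outside V(M1); counting endpoints, there are at least 2 mu - 3 m - 2 #|D| such
   edges, and m is at least (mu - #|D|) / 2.  Fix the bipartition, let B be the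
   number of augmentable edges both of whose p-edges cross it, S the size of M2,
   and T the number of edges of M1 with both endpoints met by M2.
   - The endpoint of a crossing p-edge not met by M2 has a saturated partner, and
     there are at most S / 9 saturated vertices: T >= B - S / 9.
   - M2 meets each endpoint of M1 at most once: T >= S - m.
   - Weighting M2 by 1/9 and an edge of M1 by 1 or 8/9 gives a fractional matching
     of total weight m + T / 9, hence, the output graph being bipartite, Koenig's
     theorem gives a matching of that size.
   Thus mu(G[M1 + M2]) >= m + (B - m / 9) / 10, and B has expectation a / 4 where
   a is the number of augmentable edges. *)
Require Import Defs.
From HB Require Import structures.
From mathcomp Require Import all_boot all_order all_algebra.
From mathcomp Require Import zify ring lra.

Set Implicit Arguments.
Unset Strict Implicit.
Unset Printing Implicit Defensive.

Import Order.TTheory GRing.Theory Num.Theory.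

(** * Matchings and their sizes *)

Lemma leq_mu (V : finType) (E M : {set {set V}}) :
  matching E M -> #|M| <= mu E.
Proof. by move=> EM; exact: (@leq_bigmax_cond _ (matching E) (fun M => #|M|)). Qed.

Lemma mu_subset (V : finType) (E F : {set {set V}}) :
  E \subset F -> mu E <= mu F.
Proof.
move=> EF; apply/bigmax_leqP => M /andP[ME tM].
by apply: leq_mu; rewrite /matching (subset_trans ME EF).
Qed.

Lemma mu_attained (V : finType) (E : {set {set V}}) :
  exists M, maximum_matching E M.
Proof.
have E0 : matching E set0.
  by rewrite /matching sub0set; apply/trivIsetP => A B; rewrite inE.
have [|M EM muE] := @eq_bigmax_cond _ (matching E) (fun M => #|M|).
  by apply/card_gt0P; exists set0.
by exists M.
Qed.

Lemma trivIset_mem_eq (V : finType) (M : {set {set V}}) (f g : {set V}) v :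
  trivIset M -> f \in M -> g \in M -> v \in f -> v \in g -> f = g.
Proof.
move=> tM fM gM vf vg.
by rewrite -(def_pblock tM fM vf) -(def_pblock tM gM vg).
Qed.

Lemma card_cover_matching (V : finType) (E M : {set {set V}}) :
  simple_graph E -> matching E M -> #|cover M| = (2 * #|M|)%N.
Proof.
move=> hE /andP[/subsetP ME tM]; rewrite -(eqP tM) mulnC -sum_nat_const.
by apply: eq_bigr => f /ME /hE.
Qed.

Lemma mem_simple_edge (V : finType) (E : {set {set V}}) f v :
  simple_graph E -> f \in E -> v \in f ->
  exists2 u, u != v & f = [set v; u].
Proof.
move=> hE /hE/eqP/cards2P[a [b [ab ->]]]; rewrite !inE => /orP[]/eqP->.
  by exists b => //; rewrite eq_sym.
by exists a => //; rewrite setUC.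
Qed.

(** * Koenig's theorem for two-coloured graphs *)

Definition two_coloring (V : finType) (F : {set {set V}}) (s : pred V) : Prop :=
  forall f, f \in F -> exists u v, [/\ f = [set u; v], s u & ~~ s v].

Definition vertex_cover (V : finType) (F : {set {set V}}) (C : {set V}) : Prop :=
  forall f, f \in F -> ~~ [disjoint f & C].

Lemma not_disjointP (V : finType) (A B : {set V}) :
  reflect (exists2 v, v \in A & v \in B) (~~ [disjoint A & B]).
Proof.
apply: (iffP idP) => [/pred0Pn[v /andP[]]|[v vA vB]]; first by exists v.
by apply/pred0Pn; exists v; apply/andP.
Qed.

(** The covered vertices of colour [s] form the cover: each edge has exactly one, so [pblock F] is
    injective on them. *)
Lemma trivIset_vertex_cover (V : finType) (F : {set {set V}}) (s : pred V) :
  two_coloring F s -> trivIset F ->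
  exists2 C, vertex_cover F C & #|C| <= #|F|.
Proof.
move=> sF tF; exists [set v in cover F | s v].
  move=> f fF; have [u [v [fE su sv]]] := sF f fF.
  have uf : u \in f by rewrite fE set21.
  apply/not_disjointP; exists u; rewrite // inE su andbT.
  by apply/bigcupP; exists f.
rewrite -(card_in_imset (f := pblock F)).
  apply/subset_leq_card/subsetP => _ /imsetP[v /[!inE]/andP[vF _] ->].
  exact: pblock_mem.
move=> u v /[!inE]/andP[uF su] /andP[vF sv] uv.
have [a [b [fE sa sb]]] := sF _ (pblock_mem uF).
have := uF; rewrite -mem_pblock fE !inE => /orP[/eqP->|/eqP ub]; last first.
  by rewrite -ub su in sb.
have := vF; rewrite -mem_pblock -uv fE !inE => /orP[/eqP->//|/eqP vb].
by rewrite -vb sv in sb.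
Qed.

(* Lovász: if two edges e, f meet in x, and Ce, Cf are covers of the graph
   without e, resp. without f, then every edge either meets Ce :&: Cf or lies
   inside x |: (Ce symmetric difference Cf), where the smaller colour class
   covers it. *)
Lemma koenig (V : finType) (F : {set {set V}}) (s : pred V) :
  two_coloring F s -> exists2 C, vertex_cover F C & #|C| <= mu F.
Proof.
have [n] := ubnP #|F|; elim: n F => // n IH F /ltnSE leFn sF.
have [tF|] := boolP (trivIset F).
  have [C CF leC] := trivIset_vertex_cover sF tF.
  by exists C => //; apply: leq_trans leC (leq_mu _); rewrite /matching subxx.
move=> ntF.
have [e [f [eF fF ef nd]]] :
    exists e f, [/\ e \in F, f \in F, e != f & ~~ [disjoint e & f]].
  have [/existsP[e /existsP[f /and4P[]]]|] := boolP [exists e, exists f,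
      [&& e \in F, f \in F, e != f & ~~ [disjoint e & f]]].
    by exists e, f.
  rewrite negb_exists => /forallP H; case/negP: ntF; apply/trivIsetP => e f eF fF ef.
  have := H e; rewrite negb_exists => /forallP/(_ f).
  by rewrite eF fF ef /= negbK.
have [x xe xf] := elimT (not_disjointP _ _) nd.
(* A cover of [F :\ g] given by induction either covers [F], which ends the proof, or avoids [g]. *)
have coverD1 g : g \in F -> exists C, [/\ vertex_cover (F :\ g) C, #|C| <= mu F &
    vertex_cover F C \/ [disjoint g & C]].
  move=> gF; have [||C CF leC] := IH (F :\ g).
  - by apply: leq_trans leFn; rewrite [X in _ < X](cardsD1 g) gF.
  - by move=> h /[!inE]/andP[_ /sF].
  exists C; split=> //; first exact/(leq_trans leC)/mu_subset/subD1set.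
  have [gC|gC] := boolP [disjoint g & C]; [by right|left => h hF].
  by have [->//|hg] := eqVneq h g; apply: CF; rewrite !inE hg.
have [Ce [CeF leCe [CeF'|dCe]]] := coverD1 e eF; first by exists Ce.
have [Cf [CfF leCf [CfF'|dCf]]] := coverD1 f fF; first by exists Cf.
pose A := x |: ((Ce :\: Cf) :|: (Cf :\: Ce)).
have inA h : h \in F -> [disjoint h & Ce :&: Cf] ->
    exists u v, [/\ u \in h :&: A, v \in h :&: A, s u & ~~ s v].
  move=> hF dh; suff hA : h \subset A.
    have [u [v [hE su sv]]] := sF h hF; exists u, v; split=> //.
      by rewrite inE (subsetP hA) hE set21.
    by rewrite inE (subsetP hA) hE set22.
  have dI v : v \in h -> ~~ ((v \in Ce) && (v \in Cf)).
    by move=> vh; rewrite -in_setI (disjointFr dh).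
  have two g : g \in F -> forall x y v, x \in g -> y \in g -> x != y -> v \in g ->
      v = x \/ v = y.
    move=> gF a1 a2 v; have [a [b [-> _ _]]] := sF g gF; rewrite !inE.
    move=> /orP[]/eqP-> /orP[]/eqP->; rewrite ?eqxx // => _ /orP[]/eqP->;
      by [left|right].
  have share g (C : {set V}) : g \in F -> x \in g -> ~~ [disjoint g & C] -> x \notin C ->
      forall v, v \in g -> v = x \/ v \in C.
    move=> gF xg /not_disjointP[y yg yC] xC v.
    have yx : x != y by apply: contraNneq xC => ->.
    by move=> /(two _ gF _ _ v xg yg yx)[]->; [left|right].
  have xCe : x \notin Ce by rewrite (disjointFr dCe xe).
  have xCf : x \notin Cf by rewrite (disjointFr dCf xf).
  apply/subsetP => v vh; have := dI v vh; rewrite !inE.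
  (* As [x] is in neither cover, the other end of [e] is in [Cf] and that of [f] in [Ce]. Any other
     [h] meets both covers, at distinct ends since it avoids their intersection. *)
  have [he|he] := eqVneq h e.
    have [||||->|vC] := share h Cf _ _ _ xCf v => //; rewrite ?he ?eqxx //.
      by apply: CfF; rewrite !inE ef.
    by rewrite vC andbT => ->; rewrite orbT.
  have [hf|hf] := eqVneq h f.
    have [||||->|vC] := share h Ce _ _ _ xCe v => //; rewrite ?hf ?eqxx //.
      by apply: CeF; rewrite !inE eq_sym ef.
    by rewrite vC /= => ->; rewrite orbT.
  have /not_disjointP[y yh yC] : ~~ [disjoint h & Ce] by apply: CeF; rewrite !inE he.
  have /not_disjointP[z zh zC] : ~~ [disjoint h & Cf] by apply: CfF; rewrite !inE hf.
  have := dI y yh; have := dI z zh; rewrite yC zC andbT /= => zCe yCf.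
  have yz : y != z by apply: contraNneq yCf => ->.
  have [->|->] := two _ hF _ _ _ yh zh yz vh.
    by rewrite yC yCf orbT.
  by rewrite zC zCe !orbT.
(* The extra 1 pays for [x]. Twice the size of the new cover, which takes the smaller half of [A],
   is then at most [2 * mu F + 1], and parity absorbs the 1. *)
have cardA : #|A| + 2 * #|Ce :&: Cf| <= #|Ce| + #|Cf| + 1.
  have := cardsU1 x ((Ce :\: Cf) :|: (Cf :\: Ce)).
  have := cardsU (Ce :\: Cf) (Cf :\: Ce).
  have := cardsID Cf Ce; have := cardsID Ce Cf.
  rewrite (setIC Cf) -/A; case: (x \notin _) => /=; lia.
pose B := [set v | s v].
have := cardsID B A.
have cov (C : {set V}) : (forall h, h \in F -> [disjoint h & Ce :&: Cf] ->
      exists2 u, u \in h & u \in C) -> vertex_cover F ((Ce :&: Cf) :|: C).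
  move=> H h hF; have [dh|] := boolP [disjoint h & Ce :&: Cf].
    have [u uh uC] := H h hF dh.
    by apply/not_disjointP; exists u; rewrite // inE uC orbT.
  by case/not_disjointP=> u uh uC; apply/not_disjointP; exists u; rewrite // inE uC.
have [lt|le] := ltnP #|A :&: B| #|A :\: B| => cA.
  exists ((Ce :&: Cf) :|: (A :&: B)).
    apply: cov => h hF /(inA h hF)[u [v [/setIP[uh uA] _ su _]]].
    by exists u; rewrite // in_setI uA inE.
  by have := cardsU (Ce :&: Cf) (A :&: B); lia.
exists ((Ce :&: Cf) :|: (A :\: B)).
  apply: cov => h hF /(inA h hF)[u [v [_ /setIP[vh vA] _ sv]]].
  by exists v; rewrite // !in_setD vA inE sv.
by have := cardsU (Ce :&: Cf) (A :\: B); lia.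
Qed.

(** * An approximately maximal matching against a maximum one *)

Lemma matching_involution (V : finType) (E : {set {set V}}) :
  simple_graph E -> exists p : V -> V,
    [/\ involutive p, forall v, p v != v -> [set v; p v] \in E
      & #|[set v | p v != v]| = (2 * mu E)%N].
Proof.
move=> hE; have [M [EM <-]] := mu_attained E.
have /andP[/subsetP ME tM] := EM.
(* Unmatched vertices become fixed points, which makes [p] total and involutive. *)
pose p v := odflt v [pick u | (u != v) && ([set v; u] \in M)].
have pE v u : u != v -> [set v; u] \in M -> p v = u.
  move=> uv uM; rewrite /p; case: pickP => [w /andP[wv wM]|/(_ u)] /=.
    have := trivIset_mem_eq tM uM wM (set21 _ _) (set21 _ _).
    by move/setP/(_ u); rewrite !inE eqxx orbT (negPf uv) => /esym/eqP.
  by rewrite uv uM.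
have pP v : p v != v -> [set v; p v] \in M.
  by rewrite /p; case: pickP => [u /andP[]|] //=; rewrite eqxx.
exists p; split=> [v|v /pP/ME//|].
  have [pv|pv] := eqVneq (p v) v; first by rewrite !pv.
  by apply: pE; rewrite 1?eq_sym // setUC pP.
rewrite -(card_cover_matching hE EM); apply: eq_card => v; rewrite inE.
apply/idP/bigcupP => [/pP pM|[f fM vf]]; first by exists [set v; p v]; rewrite ?set21.
have [u uv fE] := mem_simple_edge hE (ME _ fM) vf.
by rewrite (pE v u) // -fE.
Qed.

Lemma card_set_pred (T : finType) (A : {set T}) (P : pred T) :
  #|[set u in A | P u]| = \sum_(u in A) P u.
Proof.
rewrite -sum1_card big_mkcond [RHS]big_mkcond; apply: eq_bigr => u _.
by rewrite inE; case: (u \in A); case: (P u).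
Qed.

Lemma maxset_matching_meets (V : finType) (E M : {set {set V}}) f :
  simple_graph E -> maxset (matching E) M -> f \in E ->
  ~~ [disjoint f & cover M].
Proof.
move=> hE /maxsetP[/andP[ME tM] maxM] fE; apply/negP => dfM.
have fM : f \in M.
  rewrite -(maxM (f |: M)) ?subsetUr ?setU11 //.
  rewrite /matching subUset sub1set fE ME /=; apply/trivIsetP.
  have dM g : g \in M -> [disjoint f & g].
    by move=> gM; apply: disjointWr dfM; apply: bigcup_sup.
  move=> A B /setU1P[->|AM] /setU1P[->|BM]; rewrite ?eqxx //.
  - by move=> _; apply: dM.
  - by rewrite disjoint_sym => _; apply: dM.
  - by move: tM => /trivIsetP; apply.
have := hE f fE; suff -> : f = set0 by rewrite cards0.
by rewrite -(disjoint_setI0 dfM) (setIidPl _) // bigcup_sup.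
Qed.

Lemma sum_cover_matching (V : finType) (E M : {set {set V}}) (F : V -> nat) :
  matching E M -> \sum_(v in cover M) F v = \sum_(f in M) \sum_(v in f) F v.
Proof. by move=> /andP[_ tM]; rewrite big_trivIset. Qed.

Lemma sum_simple_edge (V : finType) (u v : V) (F : V -> nat) :
  u != v -> \sum_(w in [set u; v]) F w = F u + F v.
Proof. by move=> uv; rewrite big_setU1 ?big_set1 ?inE. Qed.

Lemma forall_in_set2 (V : finType) (u v : V) (P : pred V) :
  [forall w in [set u; v], P w] = P u && P v.
Proof.
apply/forall_inP/andP => [H|[Pu Pv] w /set2P[]->//].
by split; apply: H; rewrite ?set21 ?set22.
Qed.

(** Since [u] is in [cover M], having [p u] outside also forces [p u != u], so both endpoints are
    matched by [p]. *)
Definition augmentable (V : finType) (M : {set {set V}}) (p : V -> V) :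
  {set {set V}} := [set f in M | [forall u in f, p u \notin cover M]].

Lemma card_augmentable (V : finType) (E M : {set {set V}}) (D : {set V})
    (p : V -> V) :
  simple_graph E -> maxset (matching (delete_vertices E D)) M ->
  involutive p -> (forall v, p v != v -> [set v; p v] \in E) ->
  #|[set v | p v != v]| = 2 * mu E ->
  2 * mu E <= #|augmentable M p| + 3 * #|M| + 2 * #|D| /\
  mu E <= 2 * #|M| + #|D|.
Proof.
move=> hE maxM pK pE cardp; have [EM _] := maxsetP maxM.
have hED : simple_graph (delete_vertices E D) by move=> f /[!inE]/andP[/hE].
pose Q := [set u in cover M | p u \notin cover M].
have cardU := card_cover_matching hED EM.
(* If neither [v] nor [p v] is in [cover M], maximality forces the edge between them to meet [D]. *)
have leW : 2 * mu E <= 2 * #|M| + #|Q| + 2 * #|D|.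
  have : [set v | p v != v] \subset cover M :|: (p @: Q) :|: (D :|: p @: D).
    apply/subsetP => v /[!inE] pv.
    have [vU|vU] := boolP (v \in cover M) => //=.
    have [pvU|pvU] := boolP (p v \in cover M).
      by rewrite -[v in v \in p @: Q]pK imset_f // inE pvU pK.
    apply/orP; right; apply: contraT; rewrite negb_or => /andP[vD vpD].
    have pvD : p v \notin D.
      by apply: contraNN vpD => pvD; rewrite -[v in v \in _]pK imset_f.
    have fE : [set v; p v] \in delete_vertices E D.
      rewrite inE pE //; apply: contraT => /not_disjointP[w /set2P[]-> wD].
        by rewrite wD in vD.
      by rewrite wD in pvD.
    have /not_disjointP[w /set2P[]-> wU] := maxset_matching_meets hED maxM fE.
      by rewrite wU in vU.
    by rewrite wU in pvU.
  move=> /subset_leq_card; rewrite cardp !cardsU cardU.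
  have := leq_imset_card p Q; have := leq_imset_card p D; lia.
(* An edge of [M] has at most one endpoint in [Q], or two if it is augmentable. The cruder bound
   [#|Q| <= 2 * #|M|] below gives the second claim. *)
have leQ : #|Q| <= #|M| + #|augmentable M p|.
  rewrite /Q /augmentable !card_set_pred (sum_cover_matching _ EM) -sum1_card.
  rewrite -big_split; apply: leq_sum => f fM; have /andP[/subsetP MD _] := EM.
  have /eqP/cards2P[a [b [ab ->]]] := hED f (MD f fM).
  rewrite sum_simple_edge // forall_in_set2; do 2!case: (_ \in cover M)=> //=.
have : #|Q| <= #|cover M|.
  by apply/subset_leq_card/subsetP => u /[!inE]/andP[].
lia.
Qed.

(** * Weak duality and maximal b-matchings *)

Lemma sum_vertex_cover (V : finType) (F : {set {set V}}) (C : {set V})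
    (w : {set V} -> nat) :
  vertex_cover F C -> (forall f, 0 < w f -> f \in F) ->
  \sum_f w f <= \sum_(v in C) \sum_(f : {set V} | v \in f) w f.
Proof.
move=> CF wF; rewrite (exchange_big_dep xpredT) //=; apply: leq_sum => f _.
have [->//|w0] := posnP (w f); rewrite sum_nat_const leq_pmull //.
have /not_disjointP[v vf vC] := CF f (wF f w0).
by apply/card_gt0P; exists v; apply/andP.
Qed.

Definition bdegree (V : finType) (x : {ffun {set V} -> nat}) (v : V) : nat :=
  \sum_(f : {set V} | v \in f) x f.

Lemma maximal_bmatching_saturated (V : finType) (E : {set {set V}})
    (cap : V -> nat) (x : {ffun {set V} -> nat}) f :
  maximal_bmatching E cap x -> f \in E ->
  exists2 v, v \in f & cap v <= bdegree x v.
Proof.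
move=> [[xE xcap] maxx] fE.
have [/existsP[v /andP[]]|] := boolP [exists v, (v \in f) && (cap v <= bdegree x v)].
  by exists v.
rewrite negb_exists => /forallP H; case: (maxx f fE); split=> [g|v].
  by rewrite ffunE; have [->//|_] := eqVneq g f; rewrite addn0 => /xE.
under eq_bigr do rewrite ffunE.
rewrite big_split /=.
have -> : \sum_(g : {set V} | v \in g) (g == f : nat) = (v \in f).
  rewrite -big_mkcondr /= sum1_card; have [vf|vf] := boolP (v \in f).
    rewrite (eq_card1 (x := f)) // => g.
    by rewrite unfold_in andbC !inE; case: eqP => // ->.
  by apply: eq_card0 => g; rewrite unfold_in andbC !inE; case: eqP => // ->; apply/negbTE.
have := H v; have := xcap v; rewrite -/(bdegree x v).
by case: (v \in f) => /=; lia.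
Qed.

(** * The bound for a fixed bipartition *)

Section Pointwise.
Variables (V : finType) (E M : {set {set V}}) (s : {ffun V -> bool}).
Variable x : {ffun {set V} -> nat}.
Hypotheses (hE : simple_graph E) (EM : matching E M) (Ms : splits M s).
Hypothesis hx : maximal_bmatching (crossing_edges E M s) (capacity 9 M) x.

Local Notation U := (cover M).
Local Notation d := (bdegree x).

Let xP f : 0 < x f ->
  exists u v, [/\ f = [set u; v], u \in U, v \notin U & s u != s v].
Proof.
case: hx => -[xE _] _ /xE; rewrite inE => /andP[_ /existsP[u /existsP[v /and4P[]]]].
by move=> /eqP-> *; exists u, v.
Qed.

Let MP f : f \in M ->
  exists u v, [/\ f = [set u; v], u != v, s u != s v, u \in U & v \in U].
Proof.
move=> fM; have /andP[/subsetP ME _] := EM.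
have /eqP/cards2P[u [v [uv fE]]] := hE (ME f fM).
exists u, v; split=> //; first by apply: Ms; rewrite -?fE.
  by apply/bigcupP; exists f; rewrite // fE set21.
by apply/bigcupP; exists f; rewrite // fE set22.
Qed.

Let dU u : u \in U -> d u <= 1.
Proof. by move=> uU; case: hx => -[_ /(_ u)]; rewrite /capacity uU. Qed.

Let dC v : v \notin U -> d v <= 9.
Proof. by move=> vU; case: hx => -[_ /(_ v)]; rewrite /capacity (negPf vU). Qed.

Let sum_d (A : {set V}) :
  \sum_(v in A) d v = \sum_f x f * #|[set v in A | v \in f]|.
Proof.
rewrite (exchange_big_dep xpredT) //=; apply: eq_bigr => f _.
by rewrite sum_nat_const mulnC; congr (_ * _); apply: eq_card => v; rewrite inE.
Qed.

Let S := \sum_f x f.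

(** Each edge in the support of [x] has exactly one end in [U], and likewise one outside [U] for
    [sum_dC]. *)
Let sum_dU : \sum_(u in U) d u = S.
Proof.
rewrite sum_d; apply: eq_bigr => f _; have [->//|x0] := posnP (x f).
have [u [v [-> uU vU _]]] := xP x0.
rewrite (_ : [set _ in U | _] = [set u]) ?cards1 ?muln1 //.
apply/setP => w; rewrite !inE; have [->|wu] /= := eqVneq w u; first by rewrite uU.
by have [->|_] := eqVneq w v; rewrite ?(negPf vU) ?andbF.
Qed.

Let sum_dC : \sum_(v in ~: U) d v = S.
Proof.
rewrite sum_d; apply: eq_bigr => f _; have [->//|x0] := posnP (x f).
have [u [v [-> uU vU _]]] := xP x0.
rewrite (_ : [set _ in _ | _] = [set v]) ?cards1 ?muln1 //.
apply/setP => w; rewrite !inE; have [->|wv] /= := eqVneq w v; first by rewrite vU orbT.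
by have [->|_] := eqVneq w u; rewrite ?uU ?andbF.
Qed.

Let T := [set f in M | [forall u in f, 0 < d u]].

Let leST : S <= #|M| + #|T|.
Proof.
rewrite -sum_dU (sum_cover_matching _ EM) card_set_pred -sum1_card -big_split.
apply: leq_sum => f /MP[u [v [-> uv _ /dU + /dU]]].
by rewrite sum_simple_edge // forall_in_set2 /=; lia.
Qed.

(* Weight 9 on every edge of M, reduced to 8 if it has an endpoint in the
   support of x, together with x itself loads no vertex by more than 9. *)
Let leT : 9 * #|M| + #|T| <= 9 * mu (output_graph M x).
Proof.
pose touched (f : {set V}) := [exists u in f, 0 < d u].
pose w f := (f \in M) * (9 - touched f) + x f.
have color : two_coloring (output_graph M x) s.
  move=> f; have ordered u v : f = [set u; v] -> s u != s v ->
      exists u v, [/\ f = [set u; v], s u & ~~ s v].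
    move=> ->; case su : (s u); case sv : (s v) => // _.
      by exists u, v; rewrite su sv.
    by exists v, u; rewrite su sv setUC.
  rewrite !inE => /orP[/MP[u [v [fE _ suv _ _]]]|/xP[u [v [fE _ _ suv]]]];
    exact: ordered fE suv.
have [C CF leC] := koenig color.
have wF f : 0 < w f -> f \in output_graph M x.
  by rewrite /w !inE; case: (f \in M).
(* Outside [U] only [x] counts. In [U], the one edge of [M] at [v] gives at most 9, and 8 when [x]
   adds its single unit at [v]. *)
have load v : \sum_(f : {set V} | v \in f) w f <= 9.
  rewrite /w big_split -/(bdegree x v) /=.
  under eq_bigr do rewrite mulnbl.
  rewrite -big_mkcondr /=; have [vU|vU] := boolP (v \in U); last first.
    rewrite big1 ?dC // => f /andP[vf fM]; case/negP: vU.
    by apply/bigcupP; exists f.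
  have /bigcupP[f fM vf] := vU; have /andP[_ tM] := EM.
  rewrite (big_pred1 f) => [|g]; last first.
    apply/andP/eqP => [[vg gM]|-> //]; exact: trivIset_mem_eq tM gM fM vg vf.
  have := dU vU; case: (posnP (d v)) => [->|d0 d1]; first by rewrite addn0 leq_subr.
  by have -> : touched f; [apply/exists_inP; exists v|lia].
have leCw : \sum_f w f <= 9 * #|C|.
  apply: leq_trans (sum_vertex_cover CF wF) _.
  by rewrite mulnC -sum_nat_const; apply: leq_sum => v _; apply: load.
suff : 9 * #|M| + #|T| <= \sum_f w f by move: leC leCw; lia.
(* Charge each copy in [x] to its end in [U]: an edge of [M] then carries 9, 8 + 1 or 8 + 2
   according to how many of its ends [x] meets. *)
rewrite /w big_split /= -/S; under eq_bigr do rewrite mulnbl.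
rewrite -big_mkcond /= -sum_dU (sum_cover_matching _ EM) card_set_pred -big_split /=.
rewrite mulnC -sum_nat_const -big_split.
apply: leq_sum => f /MP[u [v [-> uv _ /dU + /dU]]].
have -> : touched [set u; v] = (0 < d u) || (0 < d v).
  apply/exists_inP/orP => [[w' /set2P[]->]|[]]; [by left|by right| |].
    by exists u; rewrite ?set21.
  by exists v; rewrite ?set22.
by rewrite sum_simple_edge // forall_in_set2 /=; lia.
Qed.

Variable p : V -> V.
Hypotheses (pK : involutive p) (pE : forall v, p v != v -> [set v; p v] \in E).

Let B := [set f in augmentable M p | [forall u in f, s (p u) != s u]].

(** An edge of [B] outside [T] has an end [u] with [d u = 0]; the crossing edge to [p u] cannot be
    added, so [p u] has degree 9. From [p u] the edge is recovered as the block of [p (p u) = u]. *)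
Let leBT : 9 * #|B| <= 9 * #|T| + S.
Proof.
pose Q := [set v in ~: U | 9 <= d v].
have leQ : 9 * #|Q| <= S.
  rewrite -sum_dC card_set_pred big_distrr /=; apply: leq_sum => v _.
  by case: leqP => //=; rewrite muln1.
suff : #|B| <= #|T| + #|Q| by lia.
have : B \subset T :|: (fun v => pblock M (p v)) @: Q.
  apply/subsetP => f /[!inE]/andP[/andP[fM /forall_inP aug] /forall_inP cross].
  rewrite fM /=; apply/orP; have [?|] := boolP [forall u in f, 0 < d u]; first by left.
  case/forall_inPn => u uf; rewrite -eqn0Ngt => /eqP du; right.
  have uU : u \in U by apply/bigcupP; exists f.
  have puU := aug u uf.
  have pu : p u != u by apply: contraNneq puU => ->.
  have up_cross : [set u; p u] \in crossing_edges E M s.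
    rewrite inE pE //; apply/existsP; exists u; apply/existsP; exists (p u).
    by rewrite eqxx uU puU eq_sym cross.
  have [v /set2P[]->] := maximal_bmatching_saturated hx up_cross.
    by rewrite du /capacity uU.
  rewrite /capacity (negPf puU) => sat; apply/imsetP; exists (p u).
    by rewrite !inE puU.
  by have /andP[_ tM] := EM; rewrite pK (def_pblock tM fM uf).
move=> /subset_leq_card/leq_trans; apply.
rewrite cardsU (leq_trans (leq_subr _ _)) // leq_add2l.
exact: leq_imset_card.
Qed.

(** By [leBT] and [leST], [9 * #|B| <= 10 * #|T| + #|M|]; substitute into ten times [leT]. *)
Lemma mu_output_graph_ge : 89 * #|M| + 9 * #|B| <= 90 * mu (output_graph M x).
Proof.
move: leST leT leBT; move: S #|T| #|B| #|M| (mu _) => *; lia.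
Qed.

End Pointwise.

(** * Expectation over the random bipartition *)

Local Open Scope ring_scope.

Section Expectation.
Variables (R : realFieldType) (V : finType) (M : {set {set V}}) (o : V -> bool).

Local Notation prob := (bipartition_prob R M o).
Local Notation expect := (@expectation R V M o).

Lemma bipartition_prob_ge0 s : 0 <= prob s.
Proof. by apply: prodr_ge0 => v _; case: ifP => _; rewrite ?ler0n ?divr_ge0. Qed.

Lemma bipartition_prob_extends s : prob s != 0 -> extends M o s.
Proof.
move=> /prodf_neq0 sM v vM; have := sM v isT.
by rewrite vM pnatr_eq0 eqb0 negbK => /eqP.
Qed.

Lemma le_expectation X Y :
  (forall s, extends M o s -> X s <= Y s) -> expect X <= expect Y.
Proof.
move=> XY; apply: ler_sum => s _.
have [->|/bipartition_prob_extends sM] := eqVneq (prob s) 0.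
  by rewrite !mul0r.
by rewrite ler_wpM2l ?bipartition_prob_ge0 ?XY.
Qed.

Lemma expectationD X Y : expect (fun s => X s + Y s) = expect X + expect Y.
Proof. by rewrite -big_split; apply: eq_bigr => s _; rewrite mulrDr. Qed.

Lemma expectationZ c X : expect (fun s => c * X s) = c * expect X.
Proof. by rewrite [RHS]big_distrr; apply: eq_bigr => s _; rewrite mulrCA. Qed.

Lemma expectation_sum (I : finType) (A : {set I}) X :
  expect (fun s => \sum_(i in A) X i s) = \sum_(i in A) expect (X i).
Proof. by rewrite exchange_big; apply: eq_bigr => s _; rewrite big_distrr. Qed.

(** Independence of the sides: the expectation of a product over vertices factors. *)
Lemma expectation_prod (h : V -> bool -> R) :
  expect (fun s => \prod_v h v (s v)) =
  \prod_v \sum_b (if v \in cover M then (b == o v)%:R else 1 / 2) * h v b.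
Proof. by rewrite bigA_distr_bigA; apply: eq_bigr => s _; rewrite -big_split. Qed.

Lemma expectation_cst c : expect (fun=> c) = c.
Proof.
have -> : expect (fun=> c) = c * expect (fun s => \prod_(v : V) 1).
  by rewrite -expectationZ; apply: eq_bigr => s _; rewrite big1 ?mulr1.
rewrite (expectation_prod (fun _ _ => 1)) big1 ?mulr1 // => v _.
rewrite big_bool /= !mulr1; case: ifP => _; last by field.
by case: (o v); rewrite ?addr0 ?add0r.
Qed.

(** The partners of the two ends are distinct and outside [cover M], so two independent fair coins
    decide the event. Comparing with [o u] instead of [s u] makes it depend on these coins alone. *)
Lemma expectation_crossing (E : {set {set V}}) (p : V -> V) f :
  simple_graph E -> matching E M -> involutive p -> f \in augmentable M p ->
  expect (fun s => [forall u in f, s (p u) != o u]%:R) = 1 / 4.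
Proof.
move=> hE /andP[/subsetP ME _] pK /[!inE]/andP[fM /forall_inP aug].
pose h v b : R := if p v \in f then (b != o (p v))%:R else 1.
transitivity (expect (fun s => \prod_v h v (s v))).
  apply: eq_bigr => s _; congr (_ * _).
  have [/forall_inP H|] := boolP [forall u in f, s (p u) != o u]; last first.
    case/forall_inPn=> u uf /negbNE/eqP Hu.
    by rewrite (bigD1 (p u)) //= /h pK uf Hu eqxx mul0r.
  rewrite big1 // => v _; rewrite /h; case: ifP => // pvf.
  by have := H _ pvf; rewrite pK => ->.
rewrite expectation_prod (eq_bigr (fun v => if v \in p @: f then 1 / 2 else 1)).
  rewrite -big_mkcond prodr_const card_imset ?(hE f (ME f fM)); last exact: inv_inj pK.
  by rewrite expr2; field.
move=> v _; rewrite -[v in v \in p @: f]pK mem_imset; last exact: inv_inj pK.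
rewrite big_bool /h /=; have [pvf|_] := boolP (p v \in f).
  have := aug _ pvf; rewrite pK => /negPf ->.
  by case: (o (p v)); rewrite /= ?mulr0 ?mulr1 ?addr0 ?add0r.
rewrite !mulr1; case: ifP => _; last by field.
by case: (o v); rewrite ?addr0 ?add0r.
Qed.

End Expectation.

Theorem theorem4p4 (R : realFieldType) (V : finType) (E : {set {set V}})
    (eps : R) (M1 : {set {set V}}) (o : V -> bool)
    (M2 : {ffun V -> bool} -> {ffun {set V} -> nat})
    (hE : simple_graph E)
    (heps : 0 < eps < 1 / 4)
    (hM1 : approx_maximal_matching E (eps / 4) M1)
    (ho : splits M1 o)
    (hM2 : forall s : {ffun V -> bool}, extends M1 o s ->
       maximal_bmatching (crossing_edges E M1 s) (capacity 9 M1) (M2 s)) :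
  let value : R :=
    expectation M1 o (fun s => (mu (output_graph M1 (M2 s)))%:R) in
  let ratio : R := 1 / 2 + 1 / 144 - eps in
  [/\ value <= (mu E)%:R,
      ratio * (mu E)%:R <= value,
      (forall out : {ffun V -> bool} -> {set {set V}},
         (forall s : {ffun V -> bool}, extends M1 o s ->
            maximum_matching (output_graph M1 (M2 s)) (out s)) ->
         approximation_in_expectation E M1 o ratio^-1 out)
    & eps <= 1 / 88 -> ratio^-1 < 1973 / 1000 * (1 + 2 * eps)].
Proof.
move=> value ratio; case: hM1 => D [leD maxM].
have [EDM _] := maxsetP maxM.
have EM : matching E M1.
  case/andP: EDM => MD tM; rewrite /matching tM andbT (subset_trans MD) //.
  by apply/subsetP => f /[!inE]/andP[].
have [p [pK pE cardp]] := matching_involution hE.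
have [le_aug le_M] := card_augmentable hE maxM pK pE cardp.
have [eps_gt0 eps_lt] := andP heps.
have ratio_gt0 : 0 < ratio by rewrite /ratio; lra.
have outE s : extends M1 o s -> output_graph M1 (M2 s) \subset E.
  move=> /hM2[[xE _] _]; rewrite subUset (andP EM).1.
  by apply/subsetP => f /[!inE]/xE /[!inE]/andP[].
have value_le : value <= (mu E)%:R.
  rewrite -(expectation_cst M1 o (mu E)%:R); apply: le_expectation => s /outE sE.
  by rewrite ler_nat mu_subset.
have value_ge : ratio * (mu E)%:R <= value.
  (* The pointwise bound in expectation: each augmentable edge lies in [B] with probability 1/4. *)
  have : 89 * #|M1|%:R + 9 / 4 * #|augmentable M1 p|%:R <= 90 * value.
    have -> : 89 * #|M1|%:R + 9 / 4 * #|augmentable M1 p|%:R =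
        expectation M1 o (fun s => 89 * #|M1|%:R + 9 *
          \sum_(f in augmentable M1 p) [forall u in f, s (p u) != o u]%:R) :> R.
      rewrite expectationD expectation_cst expectationZ expectation_sum.
      under eq_bigr => f fA do rewrite (expectation_crossing R o hE EM pK fA).
      by rewrite sumr_const -mulr_natl; field.
    rewrite -expectationZ; apply: le_expectation => s sM.
    have Ms : splits M1 s.
      move=> u v uv uvM; rewrite !sM ?ho //; apply/bigcupP;
        by exists [set u; v]; rewrite ?set21 ?set22.
    have := mu_output_graph_ge hE EM Ms (hM2 s sM) pK pE.
    rewrite card_set_pred -(ler_nat R) natrD !natrM natr_sum.
    suff -> : \sum_(f in augmentable M1 p) [forall u in f, s (p u) != s u]%:R =
        \sum_(f in augmentable M1 p) [forall u in f, s (p u) != o u]%:R :> R by [].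
    apply: eq_bigr => f /[!inE]/andP[fM _]; congr (nat_of_bool _)%:R.
    apply: eq_forallb_in => u uf.
    by rewrite (sM u) //; apply/bigcupP; exists f.
  move: le_aug; rewrite -(ler_nat R) !(natrM, natrD) => le_aug.
  move: le_M; rewrite -(ler_nat R) !(natrM, natrD) => le_M.
  have : 0 <= eps * (mu E)%:R by rewrite mulr_ge0 // ltW.
  (* Eliminating the augmentable edges and then [#|M1|] gives [90 * value >= 365/8 * (mu E - #|D|)],
     where 365/720 = 1/2 + 1/144. The loss from [D] is at most [73/144 * eps/4 * mu E]. *)
  move: leD; rewrite /ratio; lra.
split=> // [out maxout|eps_le]; last first.
  (* [ratio * (1 + 2 * eps)] equals [73/144 + eps/72 - 2 * eps^2]. It is concave in [eps] and
     exceeds 1000/1973 at both 0 and 1/88, the latter by a narrow margin. *)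
  rewrite -[_^-1]mul1r ltr_pdivrMr // /ratio; nra.
split=> [s sM|].
  have [/andP[outs tout] _] := maxout s sM.
  by rewrite /matching tout andbT (subset_trans outs) ?outE.
rewrite ler_pdivlMl //; apply: le_trans value_ge _.
by apply: le_expectation => s /maxout[_ ->].
Qed.
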